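(* Let $\mathbf X$ be a recursive ML model on a DAG $\mathcal D=(V,E)$ with ML coefficient matrix $B$. For some $i\in V$, with $\mathrm{An}(i)$ and $\mathrm{an}(i)$ taken in $\mathcal D$, let $\mathcal D_i$ be a polytree, which is a subgraph of $\mathcal D$ with node set $\mathrm{An}(i)$, such that for every $j\in\mathrm{an}(i)$, $\mathcal D_i$ has one path from $j$ to $i$ that is max-weighted in $\mathcal D$. Let $\mathbf Y_i=(Y_l,\ l\in\mathrm{An}(i))$ be the recursive ML submodel of $\mathbf X$ induced by $\mathcal D_i$. Then for all $j\in\mathrm{An}(i)$ which have the same ancestors in $\mathcal D_i$ and in $\mathcal D$, we have $X_j=Y_j$.
   Context: Let $\mathcal D=(V,E)$ be a directed acyclic graph (DAG) with $V=\{1,\dots,d\}$; write $k\to i$ if $(k,i)\in E$. For $i\in V$, $\mathrm{pa}(i)$ and $\mathrm{an}(i)$ are the parents and ancestors of $i$ (an ancestor of $i$ is a node $j$ with a directed path of length at least one from $j$ to $i$), and $\mathrm{An}(i)=\mathrm{an}(i)\cup\{i\}$. $P_{ji}$ is the set of directed paths from $j$ to $i$. A recursive max-linear (ML) model on $\mathcal D$ is a random vector $\mathbf X=(X_1,\dots,X_d)$ defined recursively by $X_i=\bigvee_{k\in \mathrm{pa}(i)} c_{ki}X_k\vee c_{ii}Z_i$, $i=1,\dots,d$, with independent non-negative random variables $Z_1,\dots,Z_d$ and positive weights $c_{ki}$, $k\in\mathrm{pa}(i)\cup\{i\}$. The weight of a path $p=[j=k_0\to k_1\to\dots\to k_n=i]$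 is $d_{ji}(p)=c_{k_0,k_0}\prod_{l=0}^{n-1}c_{k_l,k_{l+1}}$. The ML coefficient matrix $B=(b_{ij})_{d\times d}$ of $\mathbf X$ is given, for $i\in V$, by $b_{ji}=\bigvee_{p\in P_{ji}}d_{ji}(p)$ for $j\in\mathrm{an}(i)$, $b_{ii}=c_{ii}$, and $b_{ji}=0$ otherwise. A path $p$ from $j$ to $i$ is max-weighted (in $\mathcal D$) if $b_{ji}=d_{ji}(p)$. A polytree is a DAG whose underlying undirected graph has no cycles. For a subgraph $\overline{\mathcal D}=(\overline V,\overline E)$ of $\mathcal D$, with $\overline{\mathrm{pa}}(i)$ the parents of $i$ in $\overline{\mathcal D}$, the recursive ML submodel of $\mathbf X$ induced by $\overline{\mathcal D}$ is $\mathbf Y=(Y_l,\ l\in\overline V)$ defined recursively by $Y_i=\bigvee_{k\in\overline{\mathrm{pa}}(i)}c_{ki}Y_k\vee c_{ii}Z_i$, $i\in\overline V$, with the same weights $c_{ki}$ and noise variables $Z_i$ as for $\mathbf X$. A maximum over the empty set is $0$. *)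

(* Defs.v *)
From HB Require Import structures.
From mathcomp Require Import all_boot all_order all_algebra.
From mathcomp Require Import all_classical all_reals all_analysis.

Set Implicit Arguments.
Unset Strict Implicit.
Unset Printing Implicit Defensive.

Import Order.TTheory GRing.Theory Num.Theory.

Local Open Scope ring_scope.

Section Graphs.
Variable d : nat.
Implicit Types (V : {set 'I_d}) (E : rel 'I_d) (i j : 'I_d).

(* The directed path [j -> k_1 -> ... -> k_n = i] is represented by its start j
   and the sequence p = [:: k_1; ...; k_n]; p = [::] is the path of length 0. *)
Definition dipath E j i (p : seq 'I_d) : bool := path E j p && (last j p == i).

Definition acyclic E : Prop := forall s : seq 'I_d, cycle E s -> s = [::].

(* [connect] is reflexive, hence the first step: an ancestor is the origin of a
   path of length at least one. *)
Definition an E i : {set 'I_d} := [set j | [exists k, E j k && connect E k i]].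

Definition An E i : {set 'I_d} := i |: an E i.

Definition subgraph V' (E' : rel 'I_d) V E : Prop :=
  V' \subset V /\ forall k l, E' k l -> [/\ k \in V', l \in V' & E k l].

Definition undirected E : rel 'I_d := [rel k l | E k l || E l k].

(* Cycles of a simple undirected graph have at least three (distinct) nodes;
   [:: k; l] merely runs through the edge k - l back and forth. *)
Definition polytree E : Prop :=
  acyclic E /\ forall s : seq 'I_d, ucycle (undirected E) s -> (size s <= 2)%N.

Lemma acyclic_path_uniq E j (p : seq 'I_d) :
  acyclic E -> path E j p -> uniq (j :: p).
Proof.
move=> acE; elim: p j => [|k p IHp] j //= /andP[Ejk Ep].
rewrite -[X in _ && X]/(uniq (k :: p)) (IHp _ Ep) andbT.
apply/negP => jkp; have Ejkp : path E j (k :: p) by rewrite /= Ejk.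
case/splitPr: jkp Ejkp => p1 p2; rewrite cat_path /= => /and3P[Ep1 Elj _].
have cyc : cycle E (j :: p1) by rewrite /= rcons_path Ep1.
by have := acE _ cyc.
Qed.

Lemma acyclic_path_size E j (p : seq 'I_d) :
  acyclic E -> path E j p -> (size p < d)%N.
Proof.
move=> acE /(acyclic_path_uniq acE) /card_uniqP jp.
by rewrite -[X in (_ <= X)%N]card_ord -[X in (X <= _)%N]jp max_card.
Qed.

End Graphs.

Section Coefficients.
Variables (R : realType) (d : nat).
Implicit Types (E : rel 'I_d) (c : 'I_d -> 'I_d -> R) (i j : 'I_d).

Definition path_weight c j (p : seq 'I_d) : R :=
  c j j * \prod_(w <- pairmap c j p) w.

(* The range d.-bseq 'I_d (sequences of length at most d) makes the maximum
   finite; by acyclic_path_size it contains every directed path of a DAG. *)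
Definition ML_coef E c : 'M[R]_d :=
  \matrix_(j, i)
    if j == i then c i i
    else if j \in an E i then
      \big[Num.max/0]_(p : d.-bseq 'I_d | dipath E j i p) path_weight c j p
    else 0.

Definition max_weighted E c j i (p : seq 'I_d) : Prop :=
  dipath E j i p /\ ML_coef E c j i = path_weight c j p.

End Coefficients.

Section Models.
Context {disp : measure_display} {T : measurableType disp} {R : realType}.
Variables (P : probability T R) (d : nat).
Implicit Types (V : {set 'I_d}) (E : rel 'I_d) (c : 'I_d -> 'I_d -> R).
Implicit Types (Z X : 'I_d -> {RV P >-> R}).

Definition mutually_independent Z : Prop :=
  forall (J : {set 'I_d}) (A : 'I_d -> set R),
    (forall j, measurable (A j)) ->
    P (\bigcap_(j in [set` J]) (Z j @^-1` A j))%classic =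
    (\prod_(j in J) P (Z j @^-1` A j)%classic)%E.

(* X is a family indexed by V: its members outside V are irrelevant. *)
Definition ML_equations V E c Z X : Prop :=
  forall i, i \in V -> forall w : T,
    X i w = Num.max (\big[Num.max/0]_(k | E k i) (c k i * X k w)) (c i i * Z i w).

Definition recursive_ML_model E c Z X : Prop :=
  [/\ acyclic E,
      forall k i, E k i || (k == i) -> 0 < c k i,
      mutually_independent Z,
      forall i w, 0 <= Z i w
    & ML_equations [set: 'I_d] E c Z X].

End Models.

(* Main.v *)
Require Import Defs.
From HB Require Import structures.
From mathcomp Require Import all_boot all_order all_algebra.
From mathcomp Require Import all_classical all_reals all_analysis.

Set Implicit Arguments.
Unset Strict Implicit.
Unset Printing Implicit Defensive.

Import Order.TTheory GRing.Theory Num.Theory.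

Local Open Scope ring_scope.

(** Fix an outcome [w]. Unrolling the recursion, the value of a max-linear model
    at a node [j] is the largest of the numbers (weight of [p]) * [Z l w], over
    all directed paths [p] from some [l] to [j]: none exceeds it
    ([path_weight_le_ML]) and one attains it ([ML_attained]).

    Let [j] have the same ancestors in [Ei] and [E]. A path that attains
    [Y j w] is also a path of [E], so [Y j w <= X j w]. Conversely, let [p],
    from [l] to [j] in [E], attain [X j w]. As [l] is an ancestor of [j] (or
    [j] itself) in [Ei] too, there is a path [q] from [l] to [j] in [Ei], and
    there is a path [r] from [j] to [i] in [Ei]. A polytree has at most one
    directed path between two given nodes ([polytree_dipath_unique]), so the
    max-weighted path from [l] to [i] provided by the hypothesis is [q ++ r].
    It weighs at least as much as the competitor [p ++ r]; cancelling the
    common positive factor of [r], [q] weighs at least as much as [p], whence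
    [X j w <= Y j w]. *)

(** * Directed paths *)

Lemma dipath_cat (d : nat) (E : rel 'I_d) l j i (p q : seq 'I_d) :
  dipath E l j p -> dipath E j i q -> dipath E l i (p ++ q).
Proof.
move=> /andP[Ep /eqP pj] /andP[Eq /eqP qi].
by rewrite /dipath cat_path last_cat pj Ep Eq qi /=.
Qed.

Lemma sub_dipath (d : nat) (E E' : rel 'I_d) l j (p : seq 'I_d) :
  subrel E' E -> dipath E' l j p -> dipath E l j p.
Proof. by move=> sE /andP[Ep pj]; rewrite /dipath (sub_path sE Ep). Qed.

Lemma AnP (d : nat) (E : rel 'I_d) j i :
  reflect (exists p, dipath E j i p) (j \in An E i).
Proof.
rewrite /An !inE; apply: (iffP orP).
  case=> [/eqP-> | /existsP[k /andP[Ejk /connectP[p Ep iE]]]].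
    by exists [::]; rewrite /dipath /=.
  by exists (k :: p); rewrite /dipath /= Ejk Ep iE /=.
case=> [[|k p]] /andP[] /=; first by move=> _; left.
move=> /andP[Ejk Ep] /eqP pi; right; apply/existsP; exists k.
by rewrite Ejk /=; apply/connectP; exists p.
Qed.

Lemma acyclic_loop_nil (d : nat) (E : rel 'I_d) j (p : seq 'I_d) :
  acyclic E -> dipath E j j p -> p = [::].
Proof.
move=> acE /andP[Ep pj]; have := acyclic_path_uniq acE Ep.
case: p pj {Ep} => // k p /eqP /= pj.
by rewrite -[in X in X && _]pj mem_last.
Qed.

(** Induction along the edges of an acyclic graph; the number of ancestors
    decreases when passing to a parent. *)
Lemma acyclic_ind (d : nat) (E : rel 'I_d) (Q : 'I_d -> Prop) :
  acyclic E -> (forall j, (forall k, E k j -> Q k) -> Q j) -> forall j, Q j.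
Proof.
move=> acE IH j; have [n] := ubnP #|An E j|; elim: n j => // n IHn j ltn.
apply: IH => k Ekj; apply: IHn; apply: leq_trans (ltn : (_ <= n)%N).
apply/proper_card/properP; split.
  apply/fintype.subsetP => l /AnP[p lk]; apply/AnP; exists (p ++ [:: j]).
  by apply: dipath_cat lk _; rewrite /dipath /= Ekj /=.
exists j; first by rewrite /An !inE eqxx.
apply/negP => /AnP[p jk].
have kj : dipath E k j [:: j] by rewrite /dipath /= Ekj /=.
by have := acyclic_loop_nil acE (dipath_cat kj jk).
Qed.

(** Two directed paths that separate after [x] meet again, at the latest at
    their common end; between the separation and the first meeting point they
    enclose an undirected cycle. *)
Lemma polytree_dipath_unique (d : nat) (E : rel 'I_d) x y (p q : seq 'I_d) :
  polytree E -> dipath E x y p -> dipath E x y q -> p = q.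
Proof.
move=> [acE noU]; elim: p x q => [|a p IHp] x q xpy xqy.
  by move: xpy xqy => /andP[_ /eqP<-] /(acyclic_loop_nil acE).
case: q xqy => [|b q] xqy.
  by move: xqy xpy => /andP[_ /eqP<-] /(acyclic_loop_nil acE).
have [ab | abN] := eqVneq a b.
  move: xpy xqy; rewrite -ab /dipath /= -!andbA => /andP[_ apy] /andP[_ aqy].
  by congr (_ :: _); apply: IHp apy aqy.
exfalso; move: xpy xqy => /andP[Ep /eqP py] /andP[Eq /eqP qy].
have meet : has (mem (a :: p)) (b :: q).
  apply/hasP; exists y; first by rewrite -qy /= mem_last.
  by rewrite -py /= mem_last.
have Up := acyclic_path_uniq acE Ep; have Uq := acyclic_path_uniq acE Eq.
move: Ep Eq Up Uq {py qy}.
case Dq: _ _ _ / (split_find meet) => [s B B' sp BN].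
rewrite cat_rcons in Dq *.
case Dp: (a :: p) / (splitPr sp) => [A A'].
have subU : subrel E (undirected E) by move=> k l kl; rewrite /undirected /= kl.
rewrite -!cat_rcons !cat_path.
move=> /andP[/(sub_path subU) UA _] /andP[/(sub_path subU) UB _].
rewrite -!cat_cons !cat_uniq => /and3P[Axu _ _] /and3P[Bxu _ _].
(* The cycle runs from [x] along [A] to [s], and back along the reverse of [B]. *)
have /noU : ucycle (undirected E) (x :: rcons A s ++ rev B).
  apply/andP; split.
    rewrite /= rcons_cat -rev_cons cat_path UA last_rcons /=.
    have := rev_path (undirected E) x (rcons B s).
    rewrite last_rcons belast_rcons => ->.
    by rewrite (@eq_path _ _ (undirected E)) // => k l; rewrite /undirected /= orbC.
  rewrite -cat_cons cat_uniq Axu rev_uniq.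
  move: Bxu; rewrite -rcons_cons rcons_uniq /= => /and3P[_ xB ->].
  rewrite andbT has_rev; apply/hasPn => k kB; rewrite inE negb_or.
  apply/andP; split; first by apply: contraNneq xB => <-.
  have /hasPn/(_ k kB) := BN; apply: contra => kA.
  by rewrite /= Dp -cat_rcons mem_cat kA.
(* A cycle this short would leave [A] and [B] empty, that is [a = s = b]. *)
rewrite /= size_cat size_rcons size_rev.
case: A Dp {UA Axu} => // -[a_s _]; case: B Dq {UB Bxu BN} => // -[b_s _].
by rewrite a_s b_s eqxx in abN.
Qed.

(** * Path weights *)

Lemma path_weight_cat (R : realType) (d : nat) (c : 'I_d -> 'I_d -> R)
    j (p q : seq 'I_d) :
  path_weight c j (p ++ q) =
  path_weight c j p * \prod_(e <- pairmap c (last j p) q) e.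
Proof. by rewrite /path_weight pairmap_cat big_cat /= mulrA. Qed.

Lemma path_weight_rcons (R : realType) (d : nat) (c : 'I_d -> 'I_d -> R)
    l (p : seq 'I_d) j :
  path_weight c l (rcons p j) = c (last l p) j * path_weight c l p.
Proof. by rewrite -cats1 path_weight_cat /= big_seq1 mulrC. Qed.

Lemma prod_edges_gt0 (R : realType) (d : nat) (E : rel 'I_d)
    (c : 'I_d -> 'I_d -> R) j (p : seq 'I_d) :
  (forall k l, E k l -> 0 < c k l) -> path E j p ->
  0 < \prod_(e <- pairmap c j p) e.
Proof.
move=> c_gt0; elim: p j => [|k p IHp] j /=; first by rewrite big_nil.
by move=> /andP[Ejk Ep]; rewrite big_cons mulr_gt0 ?c_gt0 ?IHp.
Qed.

Lemma path_weight_le_ML_coef (R : realType) (d : nat) (E : rel 'I_d)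
    (c : 'I_d -> 'I_d -> R) l i (p : seq 'I_d) :
  acyclic E -> dipath E l i p -> path_weight c l p <= ML_coef E c l i.
Proof.
move=> acE lpi; rewrite mxE; have [li | liN] := eqVneq l i.
  by move: lpi; rewrite li => /(acyclic_loop_nil acE)->; rewrite /path_weight big_nil mulr1.
have -> : l \in an E i.
  have : l \in An E i by apply/AnP; exists p.
  by rewrite in_setU1 (negPf liN).
have szp : (size p <= d)%N.
  by apply: ltnW; apply: (acyclic_path_size acE) (proj1 (andP lpi)).
exact: (@le_bigmax_cond _ _ _ 0 (Bseq szp) (fun p : d.-bseq 'I_d => dipath E l i p)
          (fun p : d.-bseq 'I_d => path_weight c l p)).
Qed.

(** Subpaths of a max-weighted path are heaviest between their endpoints: by
    uniqueness [s] is [q ++ r], and the common tail [r] contributes the same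
    positive factor to the weights of [p ++ r] and [q ++ r]. *)
Lemma polytree_subpath_heaviest (R : realType) (d : nat) (E Ei : rel 'I_d)
    (c : 'I_d -> 'I_d -> R) l j i (p q r s : seq 'I_d) :
  acyclic E -> (forall k m, E k m -> 0 < c k m) -> subrel Ei E -> polytree Ei ->
  dipath E l j p -> dipath Ei l j q -> dipath Ei j i r ->
  dipath Ei l i s -> max_weighted E c l i s ->
  path_weight c l p <= path_weight c l q.
Proof.
move=> acE c_gt0 sE polyEi lpj lqj jri lsi [_ maxs].
have sqr := polytree_dipath_unique polyEi lsi (dipath_cat lqj jri).
have Ejri := sub_dipath sE jri.
have := path_weight_le_ML_coef c acE (dipath_cat lpj Ejri).
rewrite maxs sqr !path_weight_cat.
move: lpj lqj => /andP[_ /eqP->] /andP[_ /eqP->].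
by rewrite ler_pM2r //; apply: prod_edges_gt0 c_gt0 (proj1 (andP Ejri)).
Qed.

(** * Solutions of the max-linear equations *)

Lemma path_weight_le_ML (disp : measure_display) (T : measurableType disp)
    (R : realType) (P : probability T R) (d : nat) (V : {set 'I_d})
    (E : rel 'I_d) (c : 'I_d -> 'I_d -> R) (Z X : 'I_d -> {RV P >-> R})
    l j (p : seq 'I_d) (w : T) :
  (forall k m, E k m -> [/\ k \in V, m \in V & 0 < c k m]) ->
  ML_equations V E c Z X -> j \in V -> dipath E l j p ->
  path_weight c l p * Z l w <= X j w.
Proof.
move=> EV eqX; elim/last_ind: p j => [|p k IHp] j jV /andP[].
  move=> _ /= /eqP lj; rewrite lj (eqX j jV) /path_weight big_nil mulr1.
  by rewrite le_max lexx orbT.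
rewrite rcons_path last_rcons => /andP[Ep Ekj] /eqP kj.
rewrite {}kj in Ekj *; have [kV _ ckj_gt0] := EV _ _ Ekj.
rewrite (eqX j jV) le_max; apply/orP; left.
apply: (bigmax_sup (last l p)) => //.
rewrite path_weight_rcons -mulrA ler_pM2l //; apply: IHp => //.
by rewrite /dipath Ep /=.
Qed.

(** By induction along the edges: a maximum over parents is attained at a
    parent [k], and an edge prolongs a path attaining [X k w]. The bottom value
    [0] of the maximum is harmless because the noise term dominates it. *)
Lemma ML_attained (disp : measure_display) (T : measurableType disp)
    (R : realType) (P : probability T R) (d : nat) (V : {set 'I_d})
    (E : rel 'I_d) (c : 'I_d -> 'I_d -> R) (Z X : 'I_d -> {RV P >-> R})
    j (w : T) :
  acyclic E -> (forall k m, E k m -> k \in V) ->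
  (forall k, 0 <= c k k * Z k w) ->
  ML_equations V E c Z X -> j \in V ->
  exists l p, dipath E l j p /\ X j w = path_weight c l p * Z l w.
Proof.
move=> acE EV noise_ge0 eqX; move: j; apply: (acyclic_ind acE) => j IHj jV.
set M := \big[Num.max/0]_(k | E k j) (c k j * X k w).
have MP : M = 0 \/ exists2 k, E k j & M = c k j * X k w.
  rewrite /M; elim/big_ind: _ => [|u v Hu Hv|k Ekj]; first by left.
    by rewrite maxEle; case: ifP.
  by right; exists k.
have XjE : X j w = Num.max M (c j j * Z j w) := eqX j jV w.
have [MZ | ZM] := leP M (c j j * Z j w).
  exists j, [::]; rewrite /dipath /path_weight big_nil mulr1 /= eqxx; split=> //.
  by rewrite XjE; apply: max_idPr.
case: MP => [M0 | [k Ekj MkE]]; first by move: ZM; rewrite M0 ltNge noise_ge0.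
have [l [p [lpk XkE]]] := IHj k Ekj (EV _ _ Ekj).
exists l, (rcons p j); split.
  rewrite -cats1; apply: dipath_cat lpk _.
  by rewrite /dipath /= Ekj /=.
rewrite XjE (max_idPl (ltW ZM)) MkE XkE path_weight_rcons mulrA.
by case/andP: lpk => _ /eqP->.
Qed.

Theorem proposition3p7
    (disp : measure_display) (T : measurableType disp) (R : realType)
    (P : probability T R) (d : nat)
    (E : rel 'I_d) (c : 'I_d -> 'I_d -> R) (Z X : 'I_d -> {RV P >-> R})
    (modelX : recursive_ML_model E c Z X)
    (i : 'I_d) (Ei : rel 'I_d)
    (subEi : subgraph (An E i) Ei [set: 'I_d] E)
    (polyEi : polytree Ei)
    (pathsEi : forall j, j \in an E i ->
       exists p : seq 'I_d, dipath Ei j i p /\ max_weighted E c j i p)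
    (Y : 'I_d -> {RV P >-> R})
    (modelY : ML_equations (An E i) Ei c Z Y) :
  forall j, j \in An E i -> an Ei j = an E j -> X j = Y j :> (T -> R).
Proof.
move=> j jAn anj; apply/funext => w.
case: modelX => acE c_gt0 _ Z_ge0 eqX; case: subEi => _ subE.
have sE : subrel Ei E by move=> k l /subE[].
have cE_gt0 k l : E k l -> 0 < c k l by move=> Ekl; rewrite c_gt0 ?Ekl.
have noise_ge0 k : 0 <= c k k * Z k w.
  by rewrite mulr_ge0 // ltW // c_gt0 // eqxx orbT.
have pathsAn k : k \in An E i ->
    exists p, dipath Ei k i p /\ max_weighted E c k i p.
  have [-> _ | ki] := eqVneq k i; last by rewrite in_setU1 (negPf ki); apply: pathsEi.
  exists [::]; rewrite /max_weighted /dipath /= eqxx mxE eqxx.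
  by rewrite /path_weight big_nil mulr1.
apply: le_anti; apply/andP; split.
  have [|l [p [lpj ->]]] := ML_attained acE _ noise_ge0 eqX (finset.in_setT j).
    by move=> k l _; apply: finset.in_setT.
  have lAnj : l \in An Ei j by rewrite /An anj; apply/AnP; exists p.
  have [q lqj] := AnP _ _ _ lAnj.
  have [r [jri _]] := pathsAn j jAn.
  have lAni : l \in An E i.
    by apply/AnP; exists (p ++ r); apply: dipath_cat lpj (sub_dipath sE jri).
  have [s [lsi maxs]] := pathsAn l lAni.
  have pq := polytree_subpath_heaviest acE cE_gt0 sE polyEi lpj lqj jri lsi maxs.
  apply: le_trans (ler_wpM2r (Z_ge0 l w) pq) _.
  apply: path_weight_le_ML modelY jAn lqj => k m /subE[kV mV Ekm].
  by split=> //; apply: cE_gt0.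
have [|l [p [lpj ->]]] := ML_attained (proj1 polyEi) _ noise_ge0 modelY jAn.
  by move=> k l /subE[].
apply: path_weight_le_ML eqX (finset.in_setT j) (sub_dipath sE lpj) => k m Ekm.
by rewrite !finset.in_setT; split=> //; apply: cE_gt0.
Qed.
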